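(* For every integer $m\geq 0$, $$\sum_{n\geq 0}p_{\mathrm{pg}}(n,2m+1)q^n=\frac{q^{2m+1}}{(1-q^{2m+1})^{m+1}}.$$ Consequently, $$p_{\mathrm{pg}}(n,2m+1)=\begin{cases}\displaystyle\binom{\frac{n}{2m+1}+m-1}{m}, & 2m+1\mid n,\\[3mm] 0, & \text{otherwise}.\end{cases}$$
   Context: A partition of a non-negative integer $n$ into exactly $r$ parts is a sequence $\lambda=(\lambda_1,\dots,\lambda_r)$ of positive integers, written in non-decreasing order $\lambda_1\le\cdots\le\lambda_r$, with $\lambda_1+\cdots+\lambda_r=n$. It is a palindromic-gap partition if its sequence of consecutive differences is a palindrome, that is, $\lambda_{i+1}-\lambda_i=\lambda_{r-i+1}-\lambda_{r-i}$ for all $1\le i\le r-1$; the empty partition and all single-part partitions satisfy the condition vacuously. $p_{\mathrm{pg}}(n,r)$ denotes the number of palindromic-gap partitions of $n$ into exactly $r$ parts. *)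

(* Defs.v *)
From HB Require Import structures.
From mathcomp Require Import all_boot all_order all_algebra.
From mathcomp Require Import boolp.

Set Implicit Arguments.
Unset Strict Implicit.
Unset Printing Implicit Defensive.

Import GRing.Theory.

(** Palindromic-gap partitions *)

Definition is_partition (n r : nat) (s : seq nat) : bool :=
  [&& size s == r, all (leq 1) s, sorted leq s & sumn s == n].

(* Parts are indexed from 0 here, so with i := k + 1 the condition on k reads
   lambda_(i+1) - lambda_i = lambda_(r-i+1) - lambda_(r-i).  The truncated
   subtractions are exact on sorted sequences. *)
Definition palindromic_gaps (s : seq nat) : bool :=
  let r := size s in
  [forall k : 'I_r.-1,
    nth 0 s k.+1 - nth 0 s k == nth 0 s (r - k.+1) - nth 0 s (r - k.+2)].

Definition is_pg_partition (n r : nat) (s : seq nat) : bool :=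
  is_partition n r s && palindromic_gaps s.

(* No part of a partition of n exceeds n, so bounding the parts loses nothing:
   see mem_pg_partitions. *)
Definition pg_partitions (n r : nat) : seq (seq nat) :=
  [seq s <- [seq map val (tval t) | t : r.-tuple 'I_n.+1]
     | is_pg_partition n r s].

Definition p_pg (n r : nat) : nat := size (pg_partitions n r).

Lemma pg_partitions_uniq n r : uniq (pg_partitions n r).
Proof.
apply: filter_uniq; rewrite map_inj_uniq ?enum_uniq // => s t /= st.
exact/val_inj/(inj_map val_inj).
Qed.

Lemma mem_pg_partitions n r s :
  (s \in pg_partitions n r) = is_pg_partition n r s.
Proof.
rewrite mem_filter andb_idr // => /andP[/and4P[/eqP sz _ _ /eqP sn] _].
have le_n x : x \in s -> x <= n.
  by rewrite -sn; elim: s {sz sn} => //= y s IH; rewrite inE => /predU1P[->|/IH];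
     [exact: leq_addr | move/leq_trans; apply; exact: leq_addl].
have szt : size (map (@inord n) s) == r by rewrite size_map sz.
apply/imageP; exists (Tuple szt) => //=.
rewrite -map_comp map_id_in // => x /le_n xn /=.
by rewrite inordK.
Qed.

(* Binomial coefficient with integer upper index, under the convention that
   binom(a, k) = 0 unless 0 <= k <= a.  In particular binom(-1, 0) = 0. *)
Definition binomz (a : int) (k : nat) : nat :=
  if a is Posz n then 'C(n, k) else 0.

(** Formal power series in one variable *)

Local Open Scope ring_scope.

Record fps (R : Type) := Fps { coefs : nat -> R }.

Lemma fpsP (R : Type) (f g : fps R) : coefs f =1 coefs g <-> f = g.
Proof.
split=> [|-> //]; case: f g => [f] [g] /= fg.
by congr Fps; apply/funext.
Qed.

HB.instance Definition _ (R : Type) := gen_eqMixin (fps R).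
HB.instance Definition _ (R : Type) := gen_choiceMixin (fps R).

Section FpsZmodule.
Context {R : zmodType}.
Implicit Types f g h : fps R.

Definition fps_zero : fps R := Fps (fun=> 0).
Definition fps_opp f : fps R := Fps (fun n => - coefs f n).
Definition fps_add f g : fps R := Fps (fun n => coefs f n + coefs g n).

Fact fps_addA : associative fps_add.
Proof. by move=> f g h; apply/fpsP => n /=; rewrite addrA. Qed.
Fact fps_addC : commutative fps_add.
Proof. by move=> f g; apply/fpsP => n /=; rewrite addrC. Qed.
Fact fps_add0 : left_id fps_zero fps_add.
Proof. by move=> f; apply/fpsP => n /=; rewrite add0r. Qed.
Fact fps_addN : left_inverse fps_zero fps_opp fps_add.
Proof. by move=> f; apply/fpsP => n /=; rewrite addNr. Qed.

End FpsZmodule.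

HB.instance Definition _ (R : zmodType) :=
  GRing.isZmodule.Build (fps R) fps_addA fps_addC fps_add0 fps_addN.

Section FpsRing.
Context {R : comNzRingType}.
Implicit Types f g h : fps R.

Definition fps_one : fps R := Fps (fun n => (n == 0)%:R).
Definition fps_mul f g : fps R :=
  Fps (fun n => \sum_(j < n.+1) coefs f j * coefs g (n - j)).

Definition fps_trunc (N : nat) f : {poly R} := \poly_(i < N) coefs f i.

Fact coefs_mul_trunc N f g n : (n < N)%N ->
  coefs (fps_mul f g) n = (fps_trunc N f * fps_trunc N g)`_n.
Proof.
move=> nN; rewrite coefM; apply: eq_bigr => j _.
rewrite !coef_poly !ifT //; first exact: leq_ltn_trans (leq_subr _ _) nN.
by apply: leq_ltn_trans nN; rewrite -ltnS.
Qed.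

Fact fps_mulC : commutative fps_mul.
Proof.
by move=> f g; apply/fpsP => n; rewrite !(coefs_mul_trunc _ _ (ltnSn n)) mulrC.
Qed.

Fact fps_mulA : associative fps_mul.
Proof.
move=> f g h; apply/fpsP => n.
transitivity ((fps_trunc n.+1 f * (fps_trunc n.+1 g * fps_trunc n.+1 h))`_n).
  rewrite coefM; apply: eq_bigr => j _; rewrite coef_poly ltn_ord; congr (_ * _).
  by apply: coefs_mul_trunc; rewrite ltnS leq_subr.
rewrite mulrA coefM; apply: eq_bigr => j _.
by rewrite coef_poly ltnS leq_subr; congr (_ * _); rewrite -coefs_mul_trunc.
Qed.

Fact fps_mul1 : left_id fps_one fps_mul.
Proof.
move=> f; apply/fpsP => n /=; rewrite big_ord_recl /= mul1r subn0.
by rewrite big1 ?addr0 // => j _; rewrite mul0r.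
Qed.

Fact fps_mulDl : left_distributive fps_mul fps_add.
Proof.
move=> f g h; apply/fpsP => n /=; rewrite -big_split /=.
by apply: eq_bigr => j _; rewrite mulrDl.
Qed.

Fact fps_one_neq0 : fps_one != 0.
Proof.
apply/eqP => /fpsP /(_ 0%N) /= /eqP.
by rewrite oner_eq0.
Qed.

End FpsRing.

HB.instance Definition _ (R : comNzRingType) :=
  GRing.Zmodule_isComNzRing.Build (fps R)
    fps_mulA fps_mulC fps_mul1 fps_mulDl fps_one_neq0.

Section FpsUnitRing.
Context {R : comUnitRingType}.
Implicit Types f g : fps R.

Definition fps_unit : {pred fps R} := fun f => coefs f 0 \is a GRing.unit.

(* [fps_inv_coefs f n] lists the first n coefficients of 1 / f, obtained by
   solving f * g = 1 for one coefficient of g after the other. *)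
Fixpoint fps_inv_coefs f (n : nat) : seq R :=
  if n is k.+1 then
    let s := fps_inv_coefs f k in
    rcons s ((coefs f 0)^-1 *
             ((k == 0)%:R - \sum_(j < k) coefs f (k - j) * s`_j))
  else [::].

Definition fps_inv f : fps R :=
  if `[< f \in fps_unit >] then Fps (fun n => (fps_inv_coefs f n.+1)`_n) else f.

Fact size_fps_inv_coefs f n : size (fps_inv_coefs f n) = n.
Proof. by elim: n => //= n IH; rewrite size_rcons IH. Qed.

Fact nth_fps_inv_coefs f n k : (k < n)%N ->
  (fps_inv_coefs f n)`_k = (fps_inv_coefs f k.+1)`_k.
Proof.
elim: n => // n IH; rewrite ltnS leq_eqVlt => /predU1P[-> // | kn].
by rewrite [fps_inv_coefs f n.+1]/= nth_rcons size_fps_inv_coefs kn IH.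
Qed.

Fact fps_mulVx : {in fps_unit, left_inverse 1 fps_inv *%R}.
Proof.
move=> f Uf; apply/fpsP => n; rewrite /fps_inv asboolT //=.
rewrite big_ord_recr /= subnn nth_rcons size_fps_inv_coefs ltnn eqxx.
rewrite mulrAC mulVr // mul1r [X in _ + (_ - X)](eq_bigr _ (fun j _ => mulrC _ _)).
rewrite [X in X + _ = _](_ : _ = \sum_(j < n) (fps_inv_coefs f n)`_j * coefs f (n - j)).
  by rewrite addrCA subrr addr0.
by apply: eq_bigr => j _; rewrite [in RHS]nth_fps_inv_coefs.
Qed.

Fact fps_unitPl f g : g * f = 1 -> fps_unit f.
Proof.
move=> /fpsP /(_ 0%N) /=; rewrite big_ord1 subnn => gf1.
by apply/unitrPr; exists (coefs g 0); rewrite mulrC.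
Qed.

Fact fps_invr_out : {in [predC fps_unit], fps_inv =1 id}.
Proof. by move=> f Uf; rewrite /fps_inv asboolF //; apply/negP. Qed.

End FpsUnitRing.

HB.instance Definition _ (R : comUnitRingType) :=
  GRing.ComNzRing_hasMulInverse.Build (fps R)
    fps_mulVx fps_unitPl fps_invr_out.

Lemma fps_unitE (R : comUnitRingType) (f : fps R) :
  (f \is a GRing.unit) = (coefs f 0 \is a GRing.unit).
Proof. by []. Qed.

Definition fpsX (R : comNzRingType) : fps R := Fps (fun n => (n == 1)%:R).

Lemma coefs_fpsXn (R : comNzRingType) (k n : nat) :
  coefs (fpsX R ^+ k) n = (n == k)%:R.
Proof.
elim: k n => [|k IH] n; first by [].
rewrite exprS /=; case: n => [|n].
  by rewrite big_ord1 /= mul0r.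
rewrite 2!big_ord_recl /= mul0r add0r mul1r IH subn1 /= eqSS.
by rewrite big1 ?addr0 // => j _; rewrite mul0r.
Qed.

(* Main.v *)
Require Import Defs.
From mathcomp Require Import all_boot all_order all_algebra.
From mathcomp Require Import zify.

Import GRing.Theory.

(** A sorted list has palindromic gaps exactly when the sum of its [k]-th part
    from the left and its [k]-th part from the right does not depend on [k]:
    going from [k] to [k + 1] adds one gap and removes the mirrored one.  When
    there are [2 * m + 1] parts, the middle part [c] is paired with itself, so
    the common sum is [2 * c]; hence the parts add up to [(2 * m + 1) * c], and
    the [m] parts before the middle determine the others as their images under
    [x |-> 2 * c - x] ([palindromic_gaps_mirror_ext]).  These [m] parts can be
    any weakly increasing list with values in [1 .. c], because the images are
    then at least [c] and in the right order ([is_pg_partition_mirror_ext]).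
    Counting such lists as multisets gives [p_pg_mul]: for [c > 0] there are
    ['C(c - 1 + m, m)] partitions of [(2 * m + 1) * c], and there are none of a
    number that is not a positive multiple of [2 * m + 1].

    The generating function is then the expansion of [(1 - X ^ r) ^ -(m + 1)],
    whose coefficient at [X ^ (r * c)] is ['C(c + m, m)], shifted by [X ^ r].
    The expansion is checked by multiplying by [1 - X ^ r] repeatedly: this
    takes differences of coefficients at distance [r], and by Pascal's rule
    each difference lowers [m] by one ([binomial_series_mul]). *)

(** * Palindromic gaps as a mirror symmetry *)

Definition mirror (S : nat) (s : seq nat) := [seq S - x | x <- rev s].

Definition mirror_ext (c : nat) (u : seq nat) :=
  u ++ c :: mirror (2 * c) u.

Lemma size_mirror_ext c u : size (mirror_ext c u) = 2 * size u + 1.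
Proof. by rewrite size_cat /= size_map size_rev; lia. Qed.

Lemma take_mirror_ext c u : take (size u) (mirror_ext c u) = u.
Proof. exact: take_size_cat. Qed.

Lemma nth_mirror S s k : k < size s ->
  nth 0 (mirror S s) k = S - nth 0 s (size s - k.+1).
Proof. by move=> ks; rewrite (nth_map 0) ?size_rev // nth_rev. Qed.

Lemma mirrorK S s : all (geq S) s -> mirror S (mirror S s) = s.
Proof.
move=> /allP sS; rewrite /mirror -map_rev revK -map_comp map_id_in // => x xs /=.
by rewrite subKn //; apply: sS.
Qed.

Lemma mirror_mirror_ext c u : all (geq c) u ->
  mirror (2 * c) (mirror_ext c u) = mirror_ext c u.
Proof.
move=> uc; rewrite {1 2}/mirror_ext /mirror rev_cat rev_cons cat_rcons map_cat /=.
rewrite -/(mirror _ _) -/(mirror _ (mirror _ _)) mirrorK; last first.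
  by apply: sub_all uc => x /=; lia.
by congr (_ ++ _ :: _); lia.
Qed.

Lemma all_geq_mirror_ext c u : all (geq c) u ->
  all (geq (2 * c)) (mirror_ext c u).
Proof.
move=> uc; rewrite all_cat /=; apply/and3P; split; last 1 first.
- by apply/allP => _ /mapP[x _ ->] /=; apply: leq_subr.
- by apply: sub_all uc => x /=; lia.
- lia.
Qed.

(** The pair sums telescope: consecutive ones differ by a gap minus the gap in
    the mirrored position. *)
Lemma palindromic_gaps_sum s k :
  sorted leq s -> palindromic_gaps s -> k < size s ->
  nth 0 s k + nth 0 s (size s - k.+1) = nth 0 s 0 + nth 0 s (size s).-1.
Proof.
move=> s_sorted /forallP s_pal; elim: k => [|k IH] ks; first by rewrite subn1.
have kr : k < (size s).-1 by lia.
have /eqP gap := s_pal (Ordinal kr); rewrite /= in gap.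
have le_left : nth 0 s k <= nth 0 s k.+1 by apply: (sortedP 0 s_sorted).
have le_right : nth 0 s (size s - k.+2) <= nth 0 s (size s - k.+1).
  have -> : size s - k.+1 = (size s - k.+2).+1 by lia.
  by apply: (sortedP 0 s_sorted); lia.
by rewrite -IH; lia.
Qed.

Lemma palindromic_gaps_of_mirror S s :
  all (geq S) s -> mirror S s = s -> palindromic_gaps s.
Proof.
move=> /(all_nthP 0) /= sS s_mir; apply/forallP => -[k /= kr].
have mirE i : i < size s -> nth 0 s i = S - nth 0 s (size s - i.+1).
  by move=> i_s; rewrite -{1}s_mir nth_mirror.
rewrite (mirE k) ?(mirE k.+1); try lia.
have : nth 0 s (size s - k.+1) <= S by apply: sS; lia.
have : nth 0 s (size s - k.+2) <= S by apply: sS; lia.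
by lia.
Qed.

(** With an odd number of parts the middle one is its own mirror image, which
    makes the common pair sum twice the middle part. *)
Lemma palindromic_gaps_mirror_ext m s :
  size s = 2 * m + 1 -> sorted leq s -> palindromic_gaps s ->
  s = mirror_ext (nth 0 s m) (take m s).
Proof.
move=> sz s_sorted s_pal; set c := nth 0 s m.
have pair_sum k : k < size s -> nth 0 s k + nth 0 s (size s - k.+1) = 2 * c.
  move=> ks; rewrite palindromic_gaps_sum // -(palindromic_gaps_sum s m) //; try lia.
  have -> : size s - m.+1 = m by lia.
  by rewrite -/c; lia.
have sz_take : size (take m s) = m by rewrite size_takel //; lia.
rewrite -{1}(cat_take_drop m s) /mirror_ext; congr (_ ++ _).
rewrite (drop_nth 0) -/c; last lia.
congr (_ :: _); apply: (@eq_from_nth _ 0).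
  by rewrite size_drop size_map size_rev sz_take; lia.
move=> i; rewrite size_drop => i_m.
rewrite nth_drop nth_mirror sz_take ?nth_take; try lia.
have := pair_sum (m - i.+1).
have -> : size s - (m - i.+1).+1 = m.+1 + i by lia.
by lia.
Qed.

Lemma sorted_mirror_ext c u :
  sorted leq u -> all (geq c) u -> sorted leq (mirror_ext c u).
Proof.
move=> u_sorted /allP uc.
have right_ge x : x \in mirror (2 * c) u -> c <= x.
  by case/mapP=> y; rewrite mem_rev => /uc /= yc ->; lia.
rewrite (sorted_pairwise leq_trans) pairwise_cat pairwise_cons.
rewrite -!(sorted_pairwise leq_trans) u_sorted /=; apply/and3P; split.
- apply/allrelP => x y /uc /= xc; rewrite inE => /predU1P[-> //|/right_ge].
  exact: leq_trans.
- exact/allP.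
- rewrite /mirror map_rev rev_sorted sorted_map.
  by apply: sub_sorted u_sorted => x y /= xy; lia.
Qed.

Lemma sumn_mirror_ext c u : all (geq c) u ->
  sumn (mirror_ext c u) = (2 * size u + 1) * c.
Proof.
move=> uc; rewrite sumn_cat /= /mirror map_rev sumn_rev.
by elim: u uc => [|x u IH] /=; [lia | case/andP=> xc /IH; nia].
Qed.

(** * Counting *)

Lemma is_pg_partition_mirror_ext c u :
  0 < c -> sorted leq u -> all (fun x => 1 <= x <= c) u ->
  is_pg_partition ((2 * size u + 1) * c) (2 * size u + 1) (mirror_ext c u).
Proof.
move=> c0 u_sorted u_range.
have uc : all (geq c) u by apply: sub_all u_range => x /andP[].
apply/andP; split; last first.
  by apply: (palindromic_gaps_of_mirror (2 * c));
    rewrite ?all_geq_mirror_ext ?mirror_mirror_ext.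
rewrite /is_partition size_mirror_ext sumn_mirror_ext // sorted_mirror_ext //.
rewrite !eqxx /= andbT all_cat /= c0 /=; apply/andP; split.
  by apply: sub_all u_range => x /andP[].
apply/allP => _ /mapP[x + ->]; rewrite mem_rev => /(allP uc) /=; lia.
Qed.

Lemma is_pg_partition_oddP n m s : is_pg_partition n (2 * m + 1) s ->
  exists c u, [/\ s = mirror_ext c u, size u = m, 0 < c,
    sorted leq u /\ all (fun x => 1 <= x <= c) u & n = (2 * m + 1) * c].
Proof.
move=> /andP[/and4P[/eqP sz /allP s_pos s_sorted /eqP <-] s_pal].
exists (nth 0 s m), (take m s).
have sz_take : size (take m s) = m by rewrite size_takel //; lia.
have take_range : all (fun x => 1 <= x <= nth 0 s m) (take m s).
  apply/(all_nthP 0) => i; rewrite sz_take => im; rewrite nth_take //.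
  rewrite s_pos ?mem_nth /=; try lia.
  by apply: (sorted_leq_nth leq_trans leqnn) => //; rewrite ?inE; lia.
have sE := palindromic_gaps_mirror_ext _ _ sz s_sorted s_pal.
split=> //.
- by apply: s_pos; apply: mem_nth; rewrite sz addn1 ltnS leq_pmull.
- by split=> //; apply: take_sorted.
- rewrite {1}sE sumn_mirror_ext ?sz_take //.
  by apply: sub_all take_range => x /andP[].
Qed.

(** The sorted lists of length [m] with values in [1 .. d.+1], shifted down by
    one, are the sorted [m]-tuples over ['I_d.+1]. *)
Lemma p_pg_mul m d :
  p_pg ((2 * m + 1) * d.+1) (2 * m + 1) = 'C(d + m, m).
Proof.
pose left_half (t : m.-tuple 'I_d.+1) := [seq (val x).+1 | x <- t].
pose A := [set t : m.-tuple 'I_d.+1 | sorted leq [seq val i | i <- t]].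
have sz_left t : size (left_half t) = m by rewrite size_map size_tuple.
have left_inj : injective left_half.
  by move=> t t' /(inj_map (inj_comp succn_inj val_inj)) /val_inj.
rewrite [d + m]addnC -card_sorted_tuples cardE -(size_map (mirror_ext d.+1 \o left_half)).
apply/perm_size/uniq_perm.
- exact: pg_partitions_uniq.
- rewrite map_inj_uniq ?enum_uniq // => t t' /= eq_ext; apply: left_inj.
  by rewrite -(take_mirror_ext d.+1 (left_half t)) eq_ext sz_left
             -(sz_left t') take_mirror_ext.
move=> s; rewrite mem_pg_partitions; apply/idP/mapP.
- case/is_pg_partition_oddP=> c [u [-> sz_u c0 [u_sorted u_range]]] /eqP.
  rewrite eqn_pmul2l; last lia.
  move=> /eqP dc; rewrite -dc in u_range *.
  have sz_t : size [seq @inord d x.-1 | x <- u] == m by rewrite size_map sz_u.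
  have left_u : left_half (Tuple sz_t) = u.
    rewrite /left_half /= -map_comp map_id_in // => x /(allP u_range) /=.
    by move=> xr; rewrite inordK; lia.
  exists (Tuple sz_t); last by rewrite /= left_u.
  rewrite mem_enum inE; move: u_sorted; rewrite -{1}left_u !sorted_map.
  exact: sub_sorted.
- case=> t; rewrite mem_enum inE => t_sorted -> /=.
  rewrite -{1 2}(sz_left t); apply: is_pg_partition_mirror_ext => //.
    by move: t_sorted; rewrite !sorted_map; apply: sub_sorted.
  by apply/allP => _ /mapP[x _ ->] /=; apply: ltn_ord.
Qed.

Lemma p_pg_eq0 n m : (forall c, 0 < c -> n <> (2 * m + 1) * c) ->
  p_pg n (2 * m + 1) = 0.
Proof.
move=> no_c; rewrite /p_pg; case E: pg_partitions => [//|s l].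
have : s \in pg_partitions n (2 * m + 1) by rewrite E mem_head.
rewrite mem_pg_partitions => /is_pg_partition_oddP[c [u [_ _ c0 _ nE]]].
by case: (no_c c).
Qed.

(** * The binomial series *)

Local Open Scope ring_scope.

Lemma coefs_fpsXn_mul (R : comNzRingType) (k n : nat) (f : fps R) :
  coefs (fpsX R ^+ k * f) n = if (n < k)%N then 0 else coefs f (n - k).
Proof.
rewrite /=; under eq_bigr do rewrite coefs_fpsXn.
case: ltnP => [nk | kn].
  rewrite big1 // => -[j /= jn] _; case: eqP => [jk|]; last by rewrite mul0r.
  lia.
rewrite (bigD1 (Ordinal (kn : (k < n.+1)%N))) //= eqxx mul1r big1 ?addr0 // => j.
by rewrite -val_eqE /= => /negbTE ->; rewrite mul0r.
Qed.

(** The expansion of [1 / (1 - X ^ r) ^ k.+1]. *)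
Definition binomial_series (r k : nat) : fps int :=
  Fps (fun n => (if r %| n then 'C(n %/ r + k, k) else 0)%N%:Z).

Lemma coefs_mul_1subXn (r n : nat) (f : fps int) :
  coefs (f * (1 - fpsX int ^+ r)) n =
    coefs f n - (if (n < r)%N then 0 else coefs f (n - r)).
Proof. by rewrite mulrBr mulr1 [f * _]mulrC -coefs_fpsXn_mul. Qed.

(** At a multiple [n >= r] of [r] this is Pascal's rule with upper index
    [n / r + k.+1]; for [n < r] the only nonzero coefficients are at [n = 0],
    where both sides are [1]. *)
Lemma binomial_seriesS (r k : nat) : (0 < r)%N ->
  binomial_series r k.+1 * (1 - fpsX int ^+ r) = binomial_series r k.
Proof.
move=> r0; apply/fpsP => n; rewrite coefs_mul_1subXn /=.
case: ltnP => [nr | rn].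
  rewrite subr0 divn_small // !add0n !binn.
  by case: ifP.
have [c ->] : exists c, n = (c + r)%N by exists (n - r)%N; lia.
rewrite addnK dvdn_addl // divnDr // divnn r0 addn1.
by case: ifP => // _; rewrite addSn binS addnS addSn; lia.
Qed.

Lemma binomial_series0 (r : nat) : (0 < r)%N ->
  binomial_series r 0 * (1 - fpsX int ^+ r) = 1.
Proof.
move=> r0; apply/fpsP => n; rewrite coefs_mul_1subXn /= !bin0.
case: ltnP => [nr | rn].
  rewrite subr0; case: n nr => [|n] nr; first by rewrite dvdn0.
  by rewrite gtnNdvd.
by rewrite dvdn_subl // subrr; case: n rn => //; lia.
Qed.

Lemma binomial_series_mul (r k : nat) : (0 < r)%N ->
  binomial_series r k * (1 - fpsX int ^+ r) ^+ k.+1 = 1.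
Proof.
move=> r0; elim: k => [|k IH]; first exact: binomial_series0.
by rewrite exprS mulrA binomial_seriesS.
Qed.

Theorem corollary4 (m : nat) :
  (let q : fps int := fpsX int in
   Fps (fun n => (p_pg n (2 * m + 1))%:Z)
     = q ^+ (2 * m + 1) / (1 - q ^+ (2 * m + 1)) ^+ (m + 1))
  /\
  (forall n : nat,
     p_pg n (2 * m + 1)
       = if (2 * m + 1 %| n)%N
         then binomz ((n %/ (2 * m + 1))%N%:Z + m%:Z - 1) m
         else 0%N).
Proof.
have r0 : (0 < 2 * m + 1)%N by rewrite addn1.
have p_pg0 : p_pg 0 (2 * m + 1) = 0%N.
  by apply: p_pg_eq0 => c c0; nia.
have p_pg_ndvd n : ~~ (2 * m + 1 %| n)%N -> p_pg n (2 * m + 1) = 0%N.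
  by move=> ndvd; apply: p_pg_eq0 => c _ nE; rewrite nE dvdn_mulr in ndvd.
split=> [q | n].
- rewrite [(m + 1)%N]addn1.
  rewrite -[RHS](_ : q ^+ (2 * m + 1) * binomial_series (2 * m + 1) m = _).
    apply/fpsP => n; rewrite coefs_fpsXn_mul /=.
    case: (boolP (2 * m + 1 %| n)%N) => [/dvdnP[[|d] ->]|ndvd].
    + by rewrite mul0n p_pg0 r0.
    + rewrite mulnC p_pg_mul ltnNge leq_pmulr //= mulnS [X in (X - _)%N]addnC addnK.
      by rewrite dvdn_mulr // mulKn.
    + rewrite p_pg_ndvd //; case: ltnP => // rn.
      by rewrite dvdn_subl // (negbTE ndvd).
  have inv1 := binomial_series_mul (2 * m + 1) m r0.
  have unit_den : (1 - q ^+ (2 * m + 1)) ^+ m.+1 \is a GRing.unit.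
    by apply/unitrPr; exists (binomial_series (2 * m + 1) m); rewrite mulrC.
  by congr (_ * _); apply: (mulIr unit_den); rewrite mulVr.
- case: ifP => [/dvdnP[[|d] ->]|/negbT]; last exact: p_pg_ndvd.
  + rewrite mul0n p_pg0 div0n.
    (* For [m = 0] the upper index is [-1], and [binomz (-1) 0 = 0]. *)
    case: m {r0 p_pg0 p_pg_ndvd} => [//|m].
    have -> : 0%N%:Z + m.+1%:Z - 1 = m%:Z :> int by lia.
    by rewrite /= bin_small.
  + rewrite mulnK // mulnC p_pg_mul.
    have -> : d.+1%:Z + m%:Z - 1 = (d + m)%N%:Z :> int by lia.
    by [].
Qed.
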